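(* For infinitely many $k\in\mathbb{N}$, there exists a bipartite graph $G$ with $k$ terminals such that for all $\epsilon>0$, $G$ does not have a $(2-\epsilon,\,k^2/7)$-DAM.
   Context: Graphs $G=(V,E,\ell)$ are finite and undirected, with an edge length function $\ell:E\to\mathbb{R}^+$ and a designated set $T\subset V$ of $k$ vertices called terminals; the other vertices are non-terminals. $d_G$ is the shortest-path distance. A minor of $G$ is a graph obtained by a sequence of vertex deletions, edge deletions and edge contractions, where no terminal may be deleted and no two terminals may be contracted together (so every terminal survives; a super-node containing terminal $t$ is identified with $t$); a minor carries its own edge length function $\ell'$. A minor $H=(V',E',\ell')$ of $G$ is an $\alpha$-distance approximating minor ($\alpha$-DAM) of $G$ if $d_G(t,t')\le d_H(t,t')\le\alpha\cdot d_G(t,t')$ for all $t,t'\in T$. It is an $(\alpha,y)$-DAM if in addition it has at most $y$ non-terminals. *)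

(* Defs.v *)
From HB Require Import structures.
From mathcomp Require Import all_boot all_order all_algebra.
From mathcomp Require Import boolp classical_sets reals constructive_ereal ereal.

Set Implicit Arguments.
Unset Strict Implicit.
Unset Printing Implicit Defensive.

Import Order.TTheory GRing.Theory Num.Theory.
Local Open Scope ring_scope.

(* The vertices are drawn from an ambient finite type U and need not exhaust
   it, so that a minor of G lives on the same U and keeps G's terminals. *)
Record graph (U : finType) := Graph {
  vertices : {set U};
  edges : {set {set U}};
  edgesP : [forall e in edges, (e \subset vertices) && (#|e| == 2%N)]
}.

Definition bipartite (U : finType) (G : graph U) : Prop :=
  exists A B : {set U}, [/\ A :|: B = vertices G, [disjoint A & B] &
    forall e, e \in edges G ->
      exists a b, [/\ a \in A, b \in B & e = [set a; b]%SET]].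

Section Operations.
Variables (U : finType) (G : graph U).

Fact del_vertex_subproof (v : U) :
  [forall e in [set e in edges G | v \notin e],
     (e \subset vertices G :\ v) && (#|e| == 2%N)].
Proof.
apply/forall_inP => e; rewrite inE => /andP[eE ve].
have /andP[sub card] := forall_inP (edgesP G) e eE.
by rewrite finset.subsetD1 sub ve.
Qed.

Definition del_vertex (v : U) : graph U := Graph (del_vertex_subproof v).

Fact del_edge_subproof (e : {set U}) :
  [forall f in edges G :\ e, (f \subset vertices G) && (#|f| == 2%N)].
Proof.
by apply/forall_inP => f /setD1P[_ fE]; exact: (forall_inP (edgesP G) f fE).
Qed.

Definition del_edge (e : {set U}) : graph U := Graph (del_edge_subproof e).

Definition relabel (u v x : U) : U := if x == v then u else x.

(* The super-node made of u and v is named u. The cardinality test drops the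
   loop coming from uv, and parallel edges collapse because edges form a set;
   the vertex u is added back only so that the result is a graph for all u. *)
Definition contract_edges (u v : U) : {set {set U}} :=
  [set f in [set relabel u v @: e | e : {set U} in edges G]%SET | #|f| == 2%N].

Fact contract_subproof (u v : U) :
  [forall e in contract_edges u v,
     (e \subset u |: (vertices G :\ v)) && (#|e| == 2%N)].
Proof.
apply/forall_inP => f; rewrite inE => /andP[/imsetP[e eE ->] ->].
rewrite andbT; have /andP[/fintype.subsetP sub _] := forall_inP (edgesP G) e eE.
apply/fintype.subsetP => y /imsetP[x xe ->]; rewrite !inE /relabel.
by case: (eqVneq x v) => [_|xv]; rewrite ?eqxx // xv (sub _ xe) orbT.
Qed.

Definition contract (u v : U) : graph U := Graph (contract_subproof u v).

End Operations.

(* In [minor_contract] v is not a terminal, so two terminals are never merged,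
   and since the super-node is named u, a terminal u keeps its name. *)
Inductive minor (U : finType) (T : {set U}) (G : graph U) : graph U -> Prop :=
| minor_refl : minor T G G
| minor_del_vertex H v : minor T G H ->
    v \in vertices H -> v \notin T -> minor T G (del_vertex H v)
| minor_del_edge H e : minor T G H ->
    e \in edges H -> minor T G (del_edge H e)
| minor_contract H u v : minor T G H ->
    [set u; v]%SET \in edges H -> v \notin T -> minor T G (contract H u v).

Record lgraph (R : realType) (U : finType) := LGraph {
  ugraph :> graph U;
  len : {set U} -> R;
  len_gt0 : forall e, e \in edges ugraph -> 0 < len e
}.

Section Distance.
Variables (R : realType) (U : finType) (G : lgraph R U).

Definition adj (x y : U) : bool := [set x; y]%SET \in edges G.

Definition is_path (s t : U) (p : seq U) : bool :=
  [&& s \in vertices G, path adj s p, uniq (s :: p) & last s p == t].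

Fixpoint path_len (s : U) (p : seq U) : R :=
  if p is x :: q then len G [set s; x]%SET + path_len x q else 0.

(* +oo when s and t are not connected *)
Definition dist (s t : U) : \bar R :=
  ereal_inf [set (path_len s p)%:E | p in [set p | is_path s t p]]%classic.

End Distance.

Definition DAM (R : realType) (U : finType) (T : {set U}) (G H : lgraph R U)
    (alpha : R) : Prop :=
  minor T G H /\
  forall t t', t \in T -> t' \in T ->
    (dist G t t' <= dist H t t' <= alpha%:E * dist G t t')%E.

Definition DAM_size (R : realType) (U : finType) (T : {set U})
    (G H : lgraph R U) (alpha y : R) : Prop :=
  DAM T G H alpha /\ #|vertices H :\: T|%:R <= y.

(* Main.v *)
(** Take as terminals the points of a Steiner triple system and join a new
    vertex (hub) by unit edges to the three points of each triple; any two
    terminals are then at distance 2. In a minor, a path between two terminals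
    through a third one has length at least 2 + 2, so distortion below 2 forces
    each pair of terminals to be joined either by an edge or through a hub.
    Only the hub of the unique triple containing the pair can provide this, and
    contracting that hub into one of its points still loses the pair formed by
    the other two. So all k(k-1)/6 > k^2/7 hubs survive. The triple system is
    formed by the 3-subsets of (Z/3)^n with sum zero. *)
Require Import Defs.
From mathcomp Require Import all_boot all_order all_algebra.
From mathcomp Require Import lra zify.
From mathcomp Require Import reals constructive_ereal ereal.

Local Open Scope ring_scope.

Import Order.TTheory GRing.Theory Num.Theory.

Set Implicit Arguments.
Unset Strict Implicit.
Unset Printing Implicit Defensive.

(** * Unordered pairs as edges *)

Lemma set2_inj (T : finType) (a b c d : T) :
  [set a; b] = [set c; d] -> (a = c /\ b = d) \/ (a = d /\ b = c).
Proof.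
move=> E.
have /set2P a_cd : a \in [set c; d] by rewrite -E set21.
have /set2P b_cd : b \in [set c; d] by rewrite -E set22.
have /set2P c_ab : c \in [set a; b] by rewrite E set21.
have /set2P d_ab : d \in [set a; b] by rewrite E set22.
by case: a_cd c_ab => ? [] ?; case: b_cd d_ab => ? [] ?; subst; auto.
Qed.

Lemma imset_set2 (aT rT : finType) (f : aT -> rT) (a b : aT) :
  f @: [set a; b] = [set f a; f b].
Proof. by rewrite imsetU !imset_set1. Qed.

Lemma edge_endpoint (U : finType) (G : graph U) (x y : U) :
  [set x; y] \in edges G -> (x \in vertices G) && (y \in vertices G).
Proof.
move=> /(forall_inP (edgesP G)) /andP[/subsetP sub _].
by rewrite !sub ?set21 ?set22.
Qed.

(** * Splitting paths and bounding distances *)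

Section Paths.
Variables (R : realType) (U : finType) (G : lgraph R U).

Lemma adj_sym x y : adj G x y = adj G y x.
Proof. by rewrite /adj finset.setUC. Qed.

Lemma dist_le_path_len s t p :
  is_path G s t p -> (dist G s t <= (path_len G s p)%:E)%E.
Proof. by move=> st; apply: ereal_inf_lbound; exists p. Qed.

Lemma path_len_cat s p q :
  path_len G s (p ++ q) = path_len G s p + path_len G (last s p) q.
Proof. by elim: p s => [|x p IHp] s /=; rewrite ?add0r// IHp addrA. Qed.

Lemma is_path_cat s t p q : is_path G s t (p ++ q) ->
  is_path G s (last s p) p && is_path G (last s p) t q.
Proof.
rewrite /is_path cat_path last_cat -cat_cons cat_uniq => /and4P[sG].
move=> /andP[pp pq] /and3P[up pNq uq] /eqP <-.
rewrite sG pp up eqxx pq eqxx andbT /=.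
apply/and3P; split=> //; last first.
  rewrite uq andbT; apply: contra pNq => lq.
  by apply/hasP; exists (last s p) => //; exact: mem_last.
(* The junction is a vertex of [G]: it is [s] if [p] is empty, and otherwise an endpoint of the last
   edge of [p]. *)
case/lastP: p pp {pNq up pq} => [//|p x].
by rewrite rcons_path last_rcons => /andP[_ /edge_endpoint/andP[]].
Qed.

Lemma dist_add_le_path_len s t p q : is_path G s t (p ++ q) ->
  (dist G s (last s p) + dist G (last s p) t <= (path_len G s (p ++ q))%:E)%E.
Proof.
move=> /is_path_cat/andP[/dist_le_path_len sp /dist_le_path_len pq].
by rewrite path_len_cat EFinD leeD.
Qed.

End Paths.

(** * The star graph of a linear triple system and the structure of its minors *)

Section LinearTripleSystem.
Variables (V : finType) (Bs : {set {set V}}).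
Hypothesis card_block : forall B, B \in Bs -> #|B| = 3%N.
Hypothesis linear : forall B C x y, B \in Bs -> C \in Bs -> x != y ->
  x \in B -> y \in B -> x \in C -> y \in C -> B = C.

Local Notation U := (V + {set V})%type.
Local Notation term x := (inl x : U).
Local Notation hub B := (inr B : U).

Definition terminals : {set U} := [set term x | x : V].
Definition hubs : {set U} := [set hub B | B in Bs].
Definition star_edges : {set {set U}} :=
  [set [set term x; hub B] | B in Bs, x in B].

Lemma hub_nterm B : hub B \notin terminals.
Proof. by apply/imsetP => -[]. Qed.

Lemma star_edges_subproof : [forall e in star_edges,
  (e \subset terminals :|: hubs) && (#|e| == 2%N)].
Proof.
apply/forall_inP => _ /imset2P[B x BBs xB ->]; rewrite cards2 andbT.
by apply/subsetP => _ /set2P[->|->]; rewrite inE imset_f ?orbT.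
Qed.

Definition star_graph : graph U := Graph star_edges_subproof.

Lemma bipartite_star_graph : bipartite star_graph.
Proof.
exists terminals, hubs; split => //.
  by rewrite disjoint_subset; apply/subsetP => _ /imsetP[x _ ->];
    rewrite inE; apply/imsetP => -[].
move=> _ /imset2P[B x BBs xB ->]; exists (term x), (hub B).
by split=> //; apply: imset_f.
Qed.

(* In a minor of the star graph every edge is an original one or comes from
   contracting a hub into one of its terminals; a hub that has disappeared
   leaves some pair of its block without a direct edge. *)
Definition edges_from_blocks (H : graph U) := forall e, e \in edges H ->
  (exists B x, [/\ B \in Bs, x \in B & e = [set term x; hub B]]) \/
  (exists B x y, [/\ B \in Bs, x \in B, y \in B, hub B \notin vertices H &
    e = [set term x; term y]]).

Definition lost_hub_lost_pair (H : graph U) := forall B, B \in Bs ->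
  hub B \notin vertices H ->
  exists a b, [/\ a \in B, b \in B, a != b &
    [set term a; term b] \notin edges H].

Section BlockEdges.
Variable H : graph U.
Hypothesis H_edges : edges_from_blocks H.

Lemma edge_hub B y : [set hub B; y] \in edges H ->
  B \in Bs /\ exists2 x, x \in B & y = term x.
Proof.
move=> /H_edges[[C [x [CBs xC]]]|[C [x [z [_ _ _ _]]]]] /set2_inj[[]|[]] //.
by move=> [->] ->; split=> //; exists x.
Qed.

Lemma edge_term a b : a != b -> [set term a; term b] \in edges H ->
  exists B, [/\ B \in Bs, a \in B, b \in B & hub B \notin vertices H].
Proof.
move=> ab /H_edges[[C [x [_ _]]]|[C [x [y [CBs xC yC CH]]]]] /set2_inj[[]|[]] //.
  by move=> [->] [->]; exists C.
by move=> [->] [->]; exists C.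
Qed.

(** An edge between two terminals stems from a block containing both whose hub is gone; by linearity
    that block could only be [B]. *)
Lemma live_hub_no_edge B a b : B \in Bs -> hub B \in vertices H ->
  a \in B -> b \in B -> a != b -> [set term a; term b] \notin edges H.
Proof.
move=> BBs BH aB bB ab; apply/negP => /(edge_term ab)[C [CBs aC bC /negP]].
by rewrite -(linear BBs CBs ab).
Qed.

End BlockEdges.

Lemma block_pair_avoiding B c : B \in Bs -> c \in B ->
  exists a b, [/\ a \in B, b \in B, a != b, a != c & b != c].
Proof.
move=> /card_block Bs3 cB; move: (cardsD1 c B); rewrite cB Bs3 => -[] /esym/eqP.
move=> /cards2P[a [b [ab E]]]; exists a, b.
have : a \in B :\ c by rewrite E set21.
have : b \in B :\ c by rewrite E set22.
by rewrite !inE => /andP[-> ->] /andP[-> ->].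
Qed.

Lemma block_pair B : B \in Bs -> exists a b, [/\ a \in B, b \in B & a != b].
Proof.
move=> BBs; have /card_gt0P[c cB] : (0 < #|B|)%N by rewrite card_block.
by have [a [b [aB bB ab _ _]]] := block_pair_avoiding BBs cB; exists a, b.
Qed.

(** Induction on the operations. The two invariants go together: the first, through
    [live_hub_no_edge], shows that a hub has no edge inside its block at the moment it
    disappears. *)
Lemma minor_star_graph H : minor terminals star_graph H ->
  edges_from_blocks H /\ lost_hub_lost_pair H.
Proof.
elim=> {H} [|H v _ [Hedges Hlost] vH vT|H e _ [Hedges Hlost] eH
           |H u v _ [Hedges Hlost] uvH vT].
- split=> [_ /imset2P[B x BBs xB ->]|B BBs]; first by left; exists B, x.
  by rewrite inE (imset_f (fun B => hub B) BBs) orbT.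
- case: v vH vT => [x|C] CH; first by rewrite imset_f.
  move=> _; split=> [e|B BBs].
    rewrite inE => /andP[/Hedges[?|[B [x [y [BBs xB yB BH ->]]]]] _]; first by left.
    by right; exists B, x, y; split=> //; rewrite !inE (negPf BH) andbF.
  (* If [B] is the block whose hub is deleted, any pair of its points will do; otherwise the pair
     lost earlier stays lost. *)
  rewrite !inE negb_and negbK => /orP[/eqP[EB]|BH].
    rewrite -EB in CH; have [a [b [aB bB ab]]] := block_pair BBs; exists a, b; split=> //.
    by rewrite inE negb_and (live_hub_no_edge Hedges BBs).
  have [a [b [aB bB ab abH]]] := Hlost _ BBs BH; exists a, b; split=> //.
  by rewrite inE negb_and abH.
- split=> [f|B BBs].
    by move=> /setD1P[_ /Hedges].
  move=> /(Hlost _ BBs)[a [b [aB bB ab abH]]]; exists a, b; split=> //.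
  by rewrite !inE negb_and abH orbT.
(* The absorbed vertex is a hub [C], and edges at a hub lead only to points of its block, so [u] is
   some terminal [c] with [c] in [C]. *)
- case: v uvH vT => [x|C]; first by rewrite imset_f.
  rewrite finset.setUC => CuH _.
  have [CBs [c cC uc]] := edge_hub Hedges CuH; subst u.
  have /andP[CH _] := edge_endpoint CuH.
  have relabel_term x : relabel (term c) (hub C) (term x) = term x by [].
  have relabel_hub B : B != C -> relabel (term c) (hub C) (hub B) = hub B.
    by rewrite /relabel => /negPf BC; rewrite (inj_eq (@inr_inj _ _)) BC.
  have vertE B : (hub B \in vertices (Defs.contract H (term c) (hub C))) =
      (B != C) && (hub B \in vertices H).
    by rewrite !inE /= (inj_eq (@inr_inj _ _)).
  (* Three origins: edges at the other hubs, edges at [C] redirected to [c], and unchanged edges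
     between terminals. *)
  have Cedges e : e \in edges (Defs.contract H (term c) (hub C)) ->
      (exists B x, [/\ B \in Bs, x \in B, B != C & e = [set term x; hub B]]) \/
      (exists2 x, x \in C & e = [set term x; term c]) \/
      (e \in edges H /\ exists B x y, [/\ B \in Bs, x \in B, y \in B,
         hub B \notin vertices H & e = [set term x; term y]]).
    rewrite inE => /andP[/imsetP[f fH ->] _].
    case: (Hedges _ fH) => [[B [x [BBs xB fE]]]|[B [x [y [BBs xB yB BH fE]]]]].
      rewrite fE imset_set2 relabel_term.
      have [BC|BC] := eqVneq B C.
        by right; left; exists x; rewrite -?BC// /relabel eqxx.
      by left; exists B, x; rewrite relabel_hub.
    have -> : relabel (term c) (hub C) @: f = f.
      by rewrite fE imset_set2 !relabel_term.
    by right; right; split=> //; exists B, x, y.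
  split=> [e /Cedges|B BBs].
    case=> [[B [x [BBs xB _ ->]]]|[[x xC ->]|[_ [B [x [y [BBs xB yB BH ->]]]]]]].
    + by left; exists B, x.
    + by right; exists C, x, c; split=> //; rewrite vertE eqxx.
    + by right; exists B, x, y; split=> //; rewrite vertE (negPf BH) andbF.
  rewrite vertE negb_and negbK => /orP[/eqP ->|BH].
    (* Every new edge contains [c], so the two points of [C] other than [c] remain without an
       edge. *)
    have [a [b [aC bC ab ac bc]]] := block_pair_avoiding CBs cC.
    exists a, b; split=> //; apply/negP => /Cedges.
    case=> [[D [x [_ _ _ /set2_inj[[]|[]]]]] //|[[x _ /set2_inj]|]].
      by case=> -[[E] [F]]; [move: bc; rewrite F eqxx|move: ac; rewrite E eqxx].
    by move=> [+ _]; exact/negP/(live_hub_no_edge Hedges CBs).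
  have [a [b [aB bB ab abH]]] := Hlost _ BBs BH; exists a, b; split=> //.
  apply/negP => /Cedges.
  case=> [[D [x [_ _ _ /set2_inj[[]|[]]]]] //|[[x xC /set2_inj]|]].
    (* A new edge joining the lost pair of [B] would put both points in [C], so [B = C]; but the hub
       of [C] was still present in [H]. *)
    by case=> -[[E] [F]]; subst; move: BH; rewrite (linear BBs CBs ab) ?CH.
  by move=> [/(negP abH)].
Qed.

(** * Distances in the star graph and in its minors *)

Section Distances.
Variable R : realType.

Lemma star_len_gt0 (e : {set U}) : e \in edges star_graph -> (0 : R) < 1.
Proof. by []. Qed.

Definition star_lgraph : lgraph R U := LGraph star_len_gt0.

(** Each edge joins a terminal to a hub, so one unit edge cannot connect two terminals. *)
Lemma star_dist_ge2 a b : a != b ->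
  (2%:E <= dist star_lgraph (term a) (term b))%E.
Proof.
move=> ab; apply: le_ereal_inf_tmp => _ [p /and4P[_ pp _ pb] <-].
rewrite lee_fin; case: p pp pb => [_|x [|y p]] /=.
- by rewrite (inj_eq (@inl_inj _ _)) (negPf ab).
- rewrite andbT => ax /eqP xb; subst x; case/imset2P: ax => B x _ _.
  by move=> /set2_inj[[]|[]].
- move=> _ _; have : 0 <= path_len star_lgraph y p.
    by elim: p y => [|z p IHp] y //=; rewrite addr_ge0.
  by lra.
Qed.

Lemma star_dist_block B a b : B \in Bs -> a \in B -> b \in B -> a != b ->
  dist star_lgraph (term a) (term b) = 2%:E.
Proof.
move=> BBs aB bB ab; apply/le_anti; rewrite star_dist_ge2// andbT.
have adjP x : x \in B -> adj star_lgraph (term x) (hub B).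
  by move=> xB; apply: imset2_f.
have -> : (2 : R)%:E = (path_len star_lgraph (term a) [:: hub B; term b])%:E.
  by rewrite /= addr0.
apply: dist_le_path_len; rewrite /is_path /= adjP// adj_sym adjP//.
by rewrite !inE imset_f//= (inj_eq (@inl_inj _ _)) ab eqxx.
Qed.

(** Cut the path at the third terminal [c]: each half costs at least 2, whatever the edge lengths of
    [H]. *)
Lemma dist_via_term (H : lgraph R U) a b p :
  (forall x y, x != y -> (2%:E <= dist H (term x) (term y))%E) ->
  is_path H (term a) (term b) p ->
  (exists q r c, [/\ p = q ++ r, last (term a) q = term c, a != c & c != b]) ->
  (4 <= path_len H (term a) p).
Proof.
move=> H2 abp [q [r [c [pE qc ac cb]]]]; subst p.
move: abp => /dist_add_le_path_len.
rewrite qc -lee_fin; apply: le_trans.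
have -> : (4 : R)%:E = (2%:E + 2%:E)%E by rewrite -EFinD; congr _%:E; lra.
by rewrite leeD// H2.
Qed.

(* With the hub of a block gone, the pair without an edge is only joined by
   paths through a third terminal. *)
Lemma lost_hub_dist (H : lgraph R U) B :
  minor terminals star_graph H ->
  (forall x y, x != y -> (2%:E <= dist H (term x) (term y))%E) ->
  B \in Bs -> hub B \notin vertices H ->
  exists a b, [/\ a \in B, b \in B, a != b &
    (4%:E <= dist H (term a) (term b))%E].
Proof.
move=> /minor_star_graph[Hedges Hlost] H2 BBs BH.
have [a [b [aB bB ab abH]]] := Hlost _ BBs BH.
exists a, b; split=> //; apply: le_ereal_inf_tmp => _ [p abp <-].
rewrite lee_fin; apply: (dist_via_term H2) (abp) _.
move: abp => /and4P[_]; case: p => [|[c|C] p] /=.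
- by rewrite (inj_eq (@inl_inj _ _)) (negPf ab).
(* The first step reaches a terminal [c], which differs from [b] because the edge between [a] and
   [b] is missing. *)
- rewrite inE negb_or => /andP[ac _] /andP[/andP[aNc _] _] _.
  exists [:: term c], p, c; split=> //.
  by apply: contraNneq abH => <-.
(* The first step reaches a hub [C], and the second a terminal [c] of [C]. If [c] were [b], then [C]
   would be [B], whose hub is gone. *)
- move=> /andP[aC Cp] /andP[aNp _].
  move: aC; rewrite adj_sym => aC.
  have [CBs [a' aC' [E]]] := edge_hub Hedges aC; subst a'.
  case: p Cp aNp => [//|y p] /= /andP[+ _].
  rewrite /adj => /(edge_hub Hedges)[_ [c cC ->]] /=.
  rewrite !inE !negb_or => /and3P[_ ac _] _.
  exists [:: hub C; term c], p, c; split=> //.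
  apply: contraNneq BH => E; rewrite E in cC.
  rewrite (linear BBs CBs ab)//.
  by case/andP: (edge_endpoint aC).
Qed.

(** A missing hub would leave some pair at distance at least 4 in [H] but 2 in the star graph,
    forcing [alpha] to be at least 2. *)
Lemma DAM_hubs_subset (H : lgraph R U) (alpha : R) :
  alpha < 2 -> DAM terminals star_lgraph H alpha -> hubs \subset vertices H.
Proof.
move=> alpha2 [Hminor Hdist]; apply/subsetP => _ /imsetP[B BBs ->].
have {}Hdist x y : (dist star_lgraph (term x) (term y) <=
    dist H (term x) (term y) <= alpha%:E * dist star_lgraph (term x) (term y))%E.
  by apply: Hdist; apply: imset_f.
have H2 x y : x != y -> (2%:E <= dist H (term x) (term y))%E.
  by move=> xy; have /andP[+ _] := Hdist x y; apply/le_trans/star_dist_ge2.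
apply/negPn/negP => BH.
have [a [b [aB bB ab]]] := lost_hub_dist Hminor H2 BBs BH.
have /andP[_ ub] := Hdist a b.
move=> /le_trans/(_ ub); rewrite (star_dist_block BBs)// -EFinM lee_fin.
by lra.
Qed.

Lemma DAM_card_ge (H : lgraph R U) (alpha : R) : alpha < 2 ->
  DAM terminals star_lgraph H alpha ->
  (#|Bs| <= #|vertices H :\: terminals|)%N.
Proof.
move=> alpha2 /(DAM_hubs_subset alpha2) sub.
rewrite -(card_imset Bs (@inr_inj V {set V})); apply: subset_leq_card.
apply/subsetP => _ /imsetP[B BBs ->].
by rewrite inE hub_nterm (subsetP sub)// imset_f.
Qed.

End Distances.
End LinearTripleSystem.

(** * Counting pairs, and the triple system itself *)

Definition offdiag (V : finType) (A : {set V}) : {set V * V} :=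
  [set p | [&& p.1 \in A, p.2 \in A & p.1 != p.2]].

Lemma card_offdiag (V : finType) (A : {set V}) :
  #|offdiag A| = (#|A| * #|A|.-1)%N.
Proof.
rewrite -sum1_card -sum_nat_const.
rewrite (eq_bigl (fun p => (p.1 \in A) && ((p.2 \in A) && (p.1 != p.2)))); last first.
  by move=> p; rewrite inE.
rewrite -(pair_big_dep (mem A) (fun x y => (y \in A) && (x != y)) (fun _ _ => 1%N)).
apply: eq_bigr => x; rewrite -[mem A x]/(x \in A) => xA; rewrite (cardsD1 x A) xA /= -sum1_card.
by apply: eq_bigl => y; rewrite !inE andbC eq_sym.
Qed.

Section ZeroSumTriples.
Variable V : finZmodType.
Hypothesis mulr3_eq0 : forall x : V, x *+ 3 = 0.

(** For [V] a vector space over the field with three elements, these are its affine lines. *)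
Definition zero_sum_triples : {set {set V}} :=
  [set B : {set V} | (#|B| == 3%N) && (\sum_(x in B) x == 0)].

Lemma card_zero_sum_triple B : B \in zero_sum_triples -> #|B| = 3%N.
Proof. by rewrite inE => /andP[/eqP]. Qed.

Lemma zero_sum_tripleE B x y : B \in zero_sum_triples ->
  x != y -> x \in B -> y \in B -> B = [set x; y; - (x + y)].
Proof.
rewrite inE => /andP[/eqP B3 /eqP sB] xy xB yB.
have yB' : y \in B :\ x by rewrite !inE eq_sym xy.
have /eqP/cards1P[z E] : #|B :\ x :\ y| = 1%N.
  by move: (cardsD1 x B) (cardsD1 y (B :\ x)); rewrite B3 xB yB'; lia.
move: sB; rewrite (big_setD1 x)//= (big_setD1 y)//= E big_set1 addrA => /eqP.
rewrite addrC addr_eq0 => /eqP <-.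
by rewrite -(setD1K xB) -(setD1K yB') E finset.setUA.
Qed.

Lemma zero_sum_triples_linear B C x y :
  B \in zero_sum_triples -> C \in zero_sum_triples -> x != y ->
  x \in B -> y \in B -> x \in C -> y \in C -> B = C.
Proof.
move=> BBs CBs xy xB yB xC yC.
by rewrite (zero_sum_tripleE BBs xy xB yB) (zero_sum_tripleE CBs xy xC yC).
Qed.

Lemma zero_sum_triple_complete x y : x != y ->
  [set x; y; - (x + y)] \in zero_sum_triples.
Proof.
(* If [a = - (a + b)] then [a *+ 2 + b = 0 = a *+ 3], so [a = b]; hence the third point is distinct
   from the other two. *)
have dbl (a b : V) : a != b -> a != - (a + b).
  apply: contraNneq => /eqP; rewrite -subr_eq0 opprK addrA -mulr2n => /eqP E.
  apply/eqP/(@addrI _ (a *+ 2)); rewrite E.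
  by rewrite -mulrSr mulr3_eq0.
move=> xy.
have zx : - (x + y) \notin [set x; y].
  by rewrite !inE negb_or eq_sym dbl// eq_sym addrC dbl// eq_sym.
rewrite inE finset.setUC cardsU1 zx cards2 xy /=.
rewrite (big_setU1 _ zx)/= big_setU1 ?inE//= big_set1.
by rewrite addNr.
Qed.

(** Every ordered pair of distinct points lies in a triple, and a triple accounts for only 3 * 2 = 6
    such pairs. *)
Lemma card_zero_sum_triples :
  (#|V| * #|V|.-1 <= 6 * #|zero_sum_triples|)%N.
Proof.
set P := [set offdiag B | B in zero_sum_triples].
have sub : offdiag [set: V] \subset finset.cover P.
  apply/subsetP => -[x y]; rewrite !inE /= => xy.
  apply/bigcupP; exists (offdiag [set x; y; - (x + y)]).
    by rewrite imset_f// zero_sum_triple_complete.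
  by rewrite !inE !eqxx orbT /= xy.
have := subset_leq_card sub; rewrite card_offdiag cardsT => /leq_trans; apply.
apply: leq_trans (leq_card_cover P) _.
apply: (@leq_trans (\sum_(A in P) 6)).
  apply: leq_sum => _ /imsetP[B /card_zero_sum_triple B3 ->].
  by rewrite card_offdiag B3.
by rewrite sum_nat_const mulnC leq_mul2l leq_imset_card.
Qed.

End ZeroSumTriples.

Theorem theorem3p5 (R : realType) :
  forall N : nat, exists k : nat, (N < k)%N /\
    exists (U : finType) (G : lgraph R U) (T : {set U}),
      [/\ T \subset vertices G, #|T| = k, bipartite G &
        forall epsilon : R, 0 < epsilon ->
          ~ exists H : lgraph R U,
              DAM_size T G H (2 - epsilon) (k%:R ^+ 2 / 7)].
Proof.
(* The exponent [N.+2] makes the number of points exceed [N] and be at least 9. *)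
move=> N; pose V : finZmodType := 'rV['F_3]_N.+2.
have V3 (x : V) : x *+ 3 = 0.
  by apply/rowP => i; rewrite mulmxnE mxE -mulr_natr pchar_Fp_0 ?mulr0.
have cardV : #|V| = (3 ^ N.+2)%N by rewrite card_mx card_Fp// mul1n.
exists (3 ^ N.+2)%N; split.
  by rewrite (leq_trans _ (ltnW (ltn_expl N.+2 _))).
exists _, (star_lgraph (zero_sum_triples V) R), (terminals V).
split=> [|||e e0 [H [HDAM]]].
- exact: finset.subsetUl.
- by rewrite -cardV card_imset; [exact: eq_card|exact: inl_inj].
- exact: bipartite_star_graph.
have := DAM_card_ge (@card_zero_sum_triple V) (@zero_sum_triples_linear V) _ HDAM.
move=> /(_ ltac:(lra)) Bs_le.
apply/negP; rewrite -ltNge ltr_pdivrMr// -natrX -natrM ltr_nat.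
have := card_zero_sum_triples V3; rewrite cardV.
(* The inequality k(k-1)/6 > k^2/7 amounts to k > 7 for positive k. *)
have : (9 <= 3 ^ N.+2)%N by rewrite (@leq_exp2l 3 2).
by move: (3 ^ N.+2)%N Bs_le => k; nia.
Qed.
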